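(* Let $G_1=(V_1,E_1)$ and $G_2=(V_2,E_2)$ be connected graphs with disjoint vertex sets, let $v_1\in V_1$, $v_2\in V_2$, and let $G=(V_1\cup V_2,\,E_1\cup E_2\cup\{(v_1,v_2)\})$. \begin{enumerate} \item[(a)] If $\beta_{G_1}(v_1)\ne1$ and $\beta_{G_2}(v_2)\ne1$, then $\partial G=\partial G_1\cup\partial G_2$. \item[(b)] If $\beta_{G_1}(v_1)=1$ and $\beta_{G_2}(v_2)\ne1$, then $\partial G=(\partial G_1\cup\partial G_2)\setminus\{v_1\}$. \item[(c)] If $\beta_{G_1}(v_1)\ne1$ and $\beta_{G_2}(v_2)=1$, then $\partial G=(\partial G_1\cup\partial G_2)\setminus\{v_2\}$. \item[(d)] If $\beta_{G_1}(v_1)=1$ and $\beta_{G_2}(v_2)=1$, then $\partial G=(\partial G_1\cup\partial G_2)\setminus\{v_1,v_2\}$. \end{enumerate} In particular, $|\partial G|\ge\max\{|\partial G_1|,|\partial G_2|\}$.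
   Context: Graphs are finite, simple, undirected; $d_H$ and $N_H$ denote distance and neighbourhood in a graph $H$. For a connected graph $H=(V,E)$, the Steinerberger boundary is $\partial H=\{v\in V:\ \exists u\in V \text{ with } \frac{1}{\deg_H(v)}\sum_{w\in N_H(v)} d_H(w,u)<d_H(v,u)\}$, with the convention $\partial H=V$ if $|V|=1$. For $v,u\in V$, $\beta_H(v,u)=\sum_{w\in N_H(v)}[d_H(v,u)-d_H(w,u)]$ and $\beta_H(v)=\max_{u\in V}\beta_H(v,u)$ (so $\beta_H(v)=0$ for the one-vertex graph). *)

(* Defs.v *)
From HB Require Import structures.
From mathcomp Require Export all_boot all_order all_algebra.

Set Implicit Arguments.
Unset Strict Implicit.
Unset Printing Implicit Defensive.

Import Order.TTheory GRing.Theory Num.Theory.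
Local Open Scope ring_scope.

(* A finite simple undirected graph is a symmetric irreflexive relation e on a
   finite type T of vertices. *)
Definition simple_graph (T : finType) (e : rel T) : Prop :=
  symmetric e /\ irreflexive e.

Definition connected_graph (T : finType) (e : rel T) : Prop :=
  forall x y : T, connect e x y.

Definition nbhd (T : finType) (e : rel T) (v : T) : {set T} := [set w | e v w].

Definition has_walk (T : finType) (e : rel T) (x y : T) (n : nat) : bool :=
  [exists p : n.-tuple T, path e x p && (last x p == y)].

(* The least length of a walk from x to y. Lengths below #|T| suffice, by
   removing loops; the value is #|T| if there is no walk (see gdistP). *)
Definition gdist (T : finType) (e : rel T) (x y : T) : nat :=
  find (has_walk e x y) (iota 0 #|T|).

Definition boundary (T : finType) (e : rel T) : {set T} :=
  [set v | (#|T| == 1%N) ||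
     [exists u, (#|nbhd e v|%:R : rat)^-1
                  * (\sum_(w in nbhd e v) (gdist e w u)%:R)
                < (gdist e v u)%:R]].

Definition beta2 (T : finType) (e : rel T) (v u : T) : int :=
  \sum_(w in nbhd e v) ((gdist e v u)%:Z - (gdist e w u)%:Z).

(* beta2 e v v is one of the values over which the maximum ranges, so using it
   as initial value of the iterated maximum does not change the maximum. *)
Definition beta (T : finType) (e : rel T) (v : T) : int :=
  \big[Num.max/beta2 e v v]_(u : T) beta2 e v u.

(* Disjoint vertex sets are rendered by the sum type T1 + T2. *)
Definition bridge (T1 T2 : finType) (e1 : rel T1) (e2 : rel T2)
    (v1 : T1) (v2 : T2) : rel (T1 + T2)%type :=
  fun x y =>
    match x, y with
    | inl a, inl b => e1 a b
    | inr a, inr b => e2 a b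
    | inl a, inr b => (a == v1) && (b == v2)
    | inr b, inl a => (a == v1) && (b == v2)
    end.

Lemma bridge_simple (T1 T2 : finType) (e1 : rel T1) (e2 : rel T2)
    (v1 : T1) (v2 : T2) :
  simple_graph e1 -> simple_graph e2 -> simple_graph (bridge e1 e2 v1 v2).
Proof.
move=> [s1 i1] [s2 i2]; split; last by case=> a /=.
by case=> a; case=> b /=.
Qed.

Lemma gdistP (T : finType) (e : rel T) (x y : T) : connect e x y ->
  has_walk e x y (gdist e x y) /\
  (forall n, has_walk e x y n -> (gdist e x y <= n)%N).
Proof.
move=> cxy.
have has_short : has (has_walk e x y) (iota 0 #|T|).
  case/connectP: cxy => p pth ->; case/shortenP: pth => p' pth' u' _.
  apply/hasP; exists (size p').
    by rewrite mem_iota /= add0n; move/card_uniqP: u' => /= <-; exact: max_card.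
  by apply/existsP; exists (in_tuple p'); rewrite /= pth' eqxx.
have lt : (gdist e x y < #|T|)%N.
  by move: has_short; rewrite has_find size_iota.
split.
  by have := nth_find 0%N has_short; rewrite nth_iota.
move=> n wn; rewrite leqNgt; apply/negP => lt_n.
have := before_find 0%N lt_n.
by rewrite nth_iota ?(ltn_trans lt_n lt) // add0n wn.
Qed.

Lemma beta_max (T : finType) (e : rel T) (v : T) :
  (exists u, beta e v = beta2 e v u) /\ (forall u, beta2 e v u <= beta e v).
Proof.
split; last by move=> u; rewrite /beta (bigD1 u) //= le_max lexx.
rewrite /beta; elim/big_ind: _ => [|a b [u ->] [w ->]|u _]; first by exists v.
  by case: leP => _; [exists w | exists u].
by exists u.
Qed.

(* Main.v *)
Require Import Defs.
From mathcomp Require Import zify.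

Set Implicit Arguments.
Unset Strict Implicit.
Unset Printing Implicit Defensive.

Import Order.TTheory GRing.Theory Num.Theory.
Local Open Scope ring_scope.

(* In a connected graph with more than one vertex, v lies on the boundary iff
   beta(v, u) > 0 for some u. Joining the graphs by a bridge changes no beta
   value at vertices other than v1 and v2; at v1 it subtracts 1 from beta(v1, u)
   for u in G1, while any u in G2 yields 1 - deg(v1), which is positive only if
   G1 is a single vertex. Hence v1 leaves the boundary exactly when
   beta(v1) = 1. For the cardinality bound, at most v1 is lost from the boundary
   of G1, and G2 always contributes a vertex: v2 itself, or a vertex of G2
   farthest from v2. *)

(** * Graph distance through local conditions *)

Section Distance.
Variables (T : finType) (e : rel T).
Implicit Types x y z : T.

Lemma has_walkP x y n :
  reflect (exists p, [/\ path e x p, last x p = y & size p = n])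
          (has_walk e x y n).
Proof.
apply: (iffP existsP) => [[p /andP[ep /eqP lp]]|[p [ep lp sp]]].
  by exists p; rewrite size_tuple.
by rewrite -sp; exists (in_tuple p); rewrite /= ep lp eqxx.
Qed.

Lemma has_walk0 x : has_walk e x x 0.
Proof. by apply/has_walkP; exists [::]. Qed.

Lemma has_walkS x y z n : e x y -> has_walk e y z n -> has_walk e x z n.+1.
Proof.
move=> exy /has_walkP[p [ep lp sp]]; apply/has_walkP; exists (y :: p).
by split=> //=; rewrite ?exy ?sp.
Qed.

Lemma has_walk_connect x y n : has_walk e x y n -> connect e x y.
Proof. by case/has_walkP=> p [ep lp _]; apply/connectP; exists p. Qed.

(** Following the decreasing edges from [a] lowers [h] by one per step, and only [y] can have value
    0, so the walk reaches [y] after [h a] steps. *)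
Lemma has_walk_descent (h : T -> nat) y :
    (forall a, a != y -> exists2 b, e a b & h a = (h b).+1) -> h y = 0%N ->
  forall a, has_walk e a y (h a).
Proof.
move=> hD hy a; move en: (h a) => n; elim: n a en => [|n IHn] a;
  have [->|/hD[b eab ->]] := eqVneq a y; rewrite ?hy // => en.
- exact: has_walk0.
- by apply: (has_walkS eab); apply: IHn; case: en.
Qed.

Lemma has_walk_lipschitz (h : T -> nat) y :
    (forall a b, e a b -> (h a <= (h b).+1)%N) ->
  forall a n, has_walk e a y n -> (h a <= h y + n)%N.
Proof.
move=> hL a n /has_walkP[p [ep lp <-]] {n}.
elim: p a ep lp => [|b p IHp] a /=; first by move=> _ ->; rewrite addn0.
move=> /andP[/hL hab ep] lp; rewrite addnS.
by apply: leq_trans hab _; rewrite ltnS; apply: IHp.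
Qed.

(* The distance to y is the unique 1-Lipschitz function vanishing at y that
   decreases along some edge at every other vertex. *)
Lemma gdist_unique (h : T -> nat) y :
    (forall a b, e a b -> (h a <= (h b).+1)%N) ->
    (forall a, a != y -> exists2 b, e a b & h a = (h b).+1) -> h y = 0%N ->
  forall a, gdist e a y = h a.
Proof.
move=> hL hD hy a; have wa := has_walk_descent hD hy a.
have [w0 mw] := gdistP (has_walk_connect wa).
apply/eqP; rewrite eqn_leq mw //=.
by have := has_walk_lipschitz hL w0; rewrite hy.
Qed.

Lemma gdistxx x : gdist e x x = 0%N.
Proof.
have [_ mw] := gdistP (connect0 e x).
by apply/eqP; rewrite -leqn0 mw ?has_walk0.
Qed.

Hypothesis ce : connected_graph e.

Lemma gdist_edge y a b : e a b -> (gdist e a y <= (gdist e b y).+1)%N.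
Proof.
move=> eab; have [_ ->//] := gdistP (ce a y).
by apply: has_walkS eab _; have [] := gdistP (ce b y).
Qed.

(** The edge is the first step of a shortest walk from [a] to [y]. *)
Lemma gdist_descent y a :
  a != y -> exists2 b, e a b & gdist e a y = (gdist e b y).+1.
Proof.
move=> ay; have [/has_walkP[p [ep lp sp]] _] := gdistP (ce a y).
case: p => [|b p] /= in ep lp sp; first by rewrite lp eqxx in ay.
case/andP: ep => eab ep; exists b => //; apply/eqP.
rewrite eqn_leq gdist_edge //= -sp ltnS.
by have [_ ->//] := gdistP (ce b y); apply/has_walkP; exists p.
Qed.

Lemma gdist_gt0 x y : x != y -> (0 < gdist e x y)%N.
Proof. by case/gdist_descent=> b _ ->. Qed.

End Distance.

(** * The boundary in terms of the sign of [beta2] *)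

Section Boundary.
Variables (T : finType) (e : rel T).
Hypothesis ce : connected_graph e.

Lemma card1_eq (x y : T) : #|T| == 1%N -> x = y.
Proof.
move=> /eqP T1; apply/eqP; apply: contraTT (isT : true) => nxy.
by have := max_card (pred2 x y); rewrite T1 card2 nxy.
Qed.

Lemma exists_neq (v : T) : #|T| != 1%N -> exists u, u != v.
Proof.
move=> T1; have [/existsP //|] := boolP [exists u, u != v].
rewrite negb_exists => /forallP allv; case/eqP: T1.
rewrite -(card1 v); apply: eq_card => u.
by have := allv u; rewrite negbK !inE.
Qed.

Lemma exists_nbr (v : T) : #|T| != 1%N -> exists w, e v w.
Proof.
case/(exists_neq v) => u; rewrite eq_sym => /(gdist_descent ce)[w evw _].
by exists w.
Qed.

(** Multiplying the averaged inequality by the degree gives [0 < beta2 e v u]; the degree is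
    positive by connectedness once there is a second vertex. *)
Lemma mem_boundary (v : T) :
  (v \in boundary e) = (#|T| == 1%N) || [exists u, 0 < beta2 e v u].
Proof.
rewrite inE; have [//|T1 /=] := eqVneq #|T| 1%N.
have [w evw] := exists_nbr v T1.
have deg0 : (0 < #|nbhd e v|)%N by apply/card_gt0P; exists w; rewrite inE.
apply: eq_existsb => u.
rewrite ltr_pdivrMl ?ltr0n // /beta2 sumrB sumr_const subr_gt0.
rewrite -natr_sum -natrM ltr_nat -(raddf_sum Posz) -mulr_natl.
by rewrite natz -PoszM ltz_nat.
Qed.

Lemma beta2_self_le0 (v : T) : beta2 e v v <= 0.
Proof. by apply: sumr_le0 => w _; rewrite gdistxx; lia. Qed.

(** All terms are nonpositive, and at least one neighbour contributes a negative one. This rules out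
    witnesses across the bridge at a non-isolated [v1]. *)
Lemma beta2_self_lt0 (v : T) :
  irreflexive e -> #|T| != 1%N -> beta2 e v v < 0.
Proof.
move=> ie /(exists_nbr v)[w evw]; rewrite /beta2 (bigD1 w) ?inE //=.
have : (0 < gdist e w v)%N.
  by apply: gdist_gt0 => //; apply: contraTneq evw => ->; rewrite ie.
set S := (X in _ + X); have : S <= 0; last by rewrite gdistxx; lia.
by apply: sumr_le0 => i _; rewrite gdistxx; lia.
Qed.

(* Witness: a vertex farthest from v. *)
Lemma boundary_neq (v : T) :
  #|T| != 1%N -> exists2 u, u \in boundary e & u != v.
Proof.
move=> T1; have [w nwv] := exists_neq v T1.
pose u := [arg max_(u > w) gdist e u v]%N.
have umax z : (gdist e z v <= gdist e u v)%N.
  by rewrite /u; case: arg_maxnP => // i _; apply.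
have nuv : u != v.
  apply: contraTneq (gdist_gt0 ce nwv) => uv.
  by have := umax w; rewrite uv gdistxx; lia.
exists u => //; rewrite mem_boundary; apply/orP; right; apply/existsP; exists v.
have [b eub db] := gdist_descent ce nuv.
(* The neighbour [b] contributes exactly 1; the other terms are nonnegative because no vertex is
   farther from [v] than [u]. *)
rewrite /beta2 (bigD1 b) ?inE //=.
set S := (X in _ + X); have : 0 <= S; last by lia.
by apply: sumr_ge0 => i _; have := umax i; lia.
Qed.

End Boundary.

(** Needed to carry results on the first piece over to the second by symmetry. *)
Lemma boundary_iso (T T' : finType) (e : rel T) (e' : rel T') (f : T -> T') :
    bijective f -> (forall x y, e' (f x) (f y) = e x y) ->
    connected_graph e -> connected_graph e' ->
  forall x, (f x \in boundary e') = (x \in boundary e).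
Proof.
move=> bf ef ce ce' x; have injf := bij_inj bf.
have df a b : gdist e' (f a) (f b) = gdist e a b.
  symmetry; move: a; apply: gdist_unique.
  - by move=> a c eac; apply: gdist_edge; rewrite ?ef.
  - move=> a nab; have [|c] := gdist_descent ce' (a := f a) (y := f b).
      by rewrite inj_eq.
    by case: bf => g fK gK; rewrite -(gK c) ef => eac dac; exists (g c).
  - exact: gdistxx.
rewrite !mem_boundary // (bij_eq_card bf); congr orb.
have b2 u : beta2 e' (f x) (f u) = beta2 e x u.
  rewrite /beta2 (reindex f) /=; last exact: onW_bij.
  by apply: eq_big => [w|w _]; rewrite ?inE ?ef ?df.
apply/existsP/existsP => [[u]|[u]]; last by rewrite -b2; exists (f u).
by case: bf => g fK gK; rewrite -(gK u) b2; exists (g u).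
Qed.

(** * Distances and boundary of the bridged graph *)

Section Bridge.
Variables (T1 T2 : finType) (e1 : rel T1) (e2 : rel T2) (v1 : T1) (v2 : T2).
Hypotheses (ce1 : connected_graph e1) (ce2 : connected_graph e2).
Local Notation G := (bridge e1 e2 v1 v2).

(** The expected distance to [inl y]: from the second piece one must go through [v2] and [v1], and
    the successor counts the bridge. *)
Let distl y (z : T1 + T2) := match z with
  | inl a => gdist e1 a y
  | inr b => (gdist e2 b v2 + (gdist e1 v1 y).+1)%N
  end.

Let distr y (z : T1 + T2) := match z with
  | inl a => (gdist e1 a v1 + (gdist e2 v2 y).+1)%N
  | inr b => gdist e2 b y
  end.

Let distl_descent y z :
  z != inl y -> exists2 t, G z t & distl y z = (distl y t).+1.
Proof.
case: z => [a|b] nzy.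
  by have [c ec dc] := gdist_descent ce1 (nzy : a != y); exists (inl c).
have [->|/(gdist_descent ce2)[c ec dc]] := eqVneq b v2.
  (* At [v2] the decreasing edge is the bridge itself. *)
  by exists (inl v1); rewrite /= ?eqxx ?gdistxx.
by exists (inr c); rewrite //= dc.
Qed.

Let distr_descent y z :
  z != inr y -> exists2 t, G z t & distr y z = (distr y t).+1.
Proof.
case: z => [a|b] nzy; last first.
  by have [c ec dc] := gdist_descent ce2 (nzy : b != y); exists (inr c).
have [->|/(gdist_descent ce1)[c ec dc]] := eqVneq a v1.
  by exists (inr v2); rewrite /= ?eqxx ?gdistxx.
by exists (inl c); rewrite //= dc.
Qed.

Lemma gdist_bridgel z y : gdist G z (inl y) = distl y z.
Proof.
move: z; apply: gdist_unique; [|exact: distl_descent|exact: gdistxx].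
case=> [a|b] [c|d] /=.
- exact: gdist_edge.
- by case/andP=> /eqP-> /eqP->; rewrite gdistxx; lia.
- by case/andP=> /eqP-> /eqP->; rewrite gdistxx; lia.
- by move/(gdist_edge ce2 v2); lia.
Qed.

Lemma gdist_bridger z y : gdist G z (inr y) = distr y z.
Proof.
move: z; apply: gdist_unique; [|exact: distr_descent|exact: gdistxx].
case=> [a|b] [c|d] /=.
- by move/(gdist_edge ce1 v1); lia.
- by case/andP=> /eqP-> /eqP->; rewrite gdistxx; lia.
- by case/andP=> /eqP-> /eqP->; rewrite gdistxx; lia.
- exact: gdist_edge.
Qed.

Lemma bridge_connected : connected_graph G.
Proof.
move=> z [y|y].
  exact: has_walk_connect (has_walk_descent (@distl_descent y) (gdistxx _ _) z).
exact: has_walk_connect (has_walk_descent (@distr_descent y) (gdistxx _ _) z).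
Qed.

Lemma beta2_bridgeE x u :
  beta2 G (inl x) u =
    \sum_(w in nbhd e1 x) ((gdist G (inl x) u)%:Z - (gdist G (inl w) u)%:Z)
    + (if x == v1 then (gdist G (inl x) u)%:Z - (gdist G (inr v2) u)%:Z else 0).
Proof.
rewrite /beta2 big_sumType /=; congr (_ + _).
  by apply: eq_bigl => w; rewrite !inE.
have [xv|xv] := eqVneq x v1; last first.
  by apply: big_pred0 => w; rewrite inE /= (negPf xv).
by rewrite (big_pred1 v2) // => w; rewrite inE /= xv eqxx.
Qed.

(** The only new neighbour is [v2], seen from [v1]; it is one step farther from [u] than [v1] is. *)
Lemma beta2_bridgel x u :
  beta2 G (inl x) (inl u) = beta2 e1 x u - (x == v1)%:Z.
Proof.
rewrite beta2_bridgeE; congr (_ + _).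
  by apply: eq_bigr => w _; rewrite !gdist_bridgel.
by case: eqP => [->|_ //]; rewrite !gdist_bridgel /= gdistxx; lia.
Qed.

(** On the first piece, distances to [inr u] are distances to [v1] plus a constant, which cancels;
    the new neighbour [v2] of [v1] is one step closer to [u]. *)
Lemma beta2_bridger x u :
  beta2 G (inl x) (inr u) = beta2 e1 x v1 + (x == v1)%:Z.
Proof.
rewrite beta2_bridgeE; congr (_ + _).
  by apply: eq_bigr => w _; rewrite !gdist_bridger /=; lia.
by case: eqP => [->|_ //]; rewrite !gdist_bridger /= gdistxx; lia.
Qed.

Hypothesis ie1 : irreflexive e1.

Lemma inl_boundary_bridge x :
  (inl x \in boundary G)
    = (x \in boundary e1) && ~~ ((x == v1) && (beta e1 v1 == 1)).
Proof.
rewrite (mem_boundary bridge_connected) (mem_boundary ce1) card_sum.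
have -> : (#|T1| + #|T2| == 1)%N = false.
  have : (0 < #|T1|)%N by apply/card_gt0P; exists v1.
  have : (0 < #|T2|)%N by apply/card_gt0P; exists v2.
  by lia.
rewrite /=; have [->|nx] := eqVneq x v1; last first.
  rewrite andbT.
  have -> : (#|T1| == 1%N) = false.
    by apply: contraNF nx => /(card1_eq x v1) ->.
  apply/existsP/existsP => [[[u|u]]|[u]].
  - by rewrite beta2_bridgel (negPf nx) subr0; exists u.
  (* A witness across the bridge can be replaced by [v1]. *)
  - by rewrite beta2_bridger (negPf nx) addr0; exists v1.
  - by exists (inl u); rewrite beta2_bridgel (negPf nx) subr0.
have [[u0 bu0] bmax] := beta_max e1 v1.
have [c1|c1] := boolP (#|T1| == 1%N) => /=.
  have b0 u : beta2 e1 v1 u = 0.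
    rewrite /beta2 big_pred0 // => w.
    by rewrite inE (card1_eq w v1 c1) ie1.
  (* When [T1] is a single vertex, a witness across the bridge gives the value 1. *)
  rewrite bu0 b0 /=; apply/existsP; exists (inr v2).
  by rewrite beta2_bridger b0 eqxx.
apply/existsP/andP => [[[u|u]]|[/existsP[u bu] nb]].
- rewrite beta2_bridgel eqxx => bu; split.
    by apply/existsP; exists u; lia.
  by have := bmax u; lia.
- by rewrite beta2_bridger eqxx; have := beta2_self_lt0 ce1 v1 ie1 c1; lia.
(* The maximum is a positive integer other than 1, so it stays positive after subtracting 1. *)
- exists (inl u0); rewrite beta2_bridgel eqxx -bu0.
  by have := bmax u; lia.
Qed.

End Bridge.

(** Exchanging the two summands is a graph isomorphism that reduces this to the first piece. *)
Lemma inr_boundary_bridge (T1 T2 : finType) (e1 : rel T1) (e2 : rel T2)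
    (v1 : T1) (v2 : T2) :
    connected_graph e1 -> connected_graph e2 -> irreflexive e2 ->
  forall y, (inr y \in boundary (bridge e1 e2 v1 v2))
    = (y \in boundary e2) && ~~ ((y == v2) && (beta e2 v2 == 1)).
Proof.
move=> ce1 ce2 ie2 y; rewrite -(inl_boundary_bridge v2 v1 ce2 ce1 ie2).
pose swap A B (z : A + B) : B + A :=
  match z with inl a => inr a | inr b => inl b end.
apply: (boundary_iso (f := @swap T2 T1) _ _ _ _ (inl y)).
- by exists (@swap T1 T2); case.
- by case=> a [] b //=; rewrite andbC.
- exact: bridge_connected.
- exact: bridge_connected.
Qed.

(** * Counting the boundary, and the theorem *)

Lemma card_inl_inr (A B : finType) (S : {set A + B}) :
  #|S| = (#|[set a | inl a \in S]| + #|[set b | inr b \in S]|)%N.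
Proof.
rewrite -!sum1_card big_sumType /=.
by congr addn; apply: eq_bigl => z; rewrite inE.
Qed.

(* S stands for the trace on one piece of the boundary of the bridged graph. *)
Lemma card_boundary_kept (T : finType) (e : rel T) (v : T) (S : {set T}) :
    connected_graph e -> irreflexive e ->
    (forall x, (x \in S) =
       (x \in boundary e) && ~~ ((x == v) && (beta e v == 1))) ->
  (0 < #|S|)%N /\ (#|boundary e| <= #|S|.+1)%N.
Proof.
move=> ce ie SE; split.
  apply/card_gt0P; have [c1|c1] := boolP (#|T| == 1%N).
    (* On a single vertex [beta e v] is at most 0, so [v] is kept. *)
    exists v; rewrite SE mem_boundary // c1 eqxx /=.
    have [[u ->] _] := beta_max e v.
    by rewrite (card1_eq u v c1); have := beta2_self_le0 e v; lia.
  have [u ub nuv] := boundary_neq ce v c1.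
  by exists u; rewrite SE ub (negPf nuv).
rewrite (cardsD1 v) addnC -addn1 leq_add ?leq_b1 //.
apply: subset_leq_card; apply/subsetP => x; rewrite !inE => /andP[nx xb].
by rewrite SE inE xb (negPf nx).
Qed.

Theorem theorem3p7 (T1 T2 : finType) (e1 : rel T1) (e2 : rel T2)
    (hs1 : simple_graph e1) (hc1 : connected_graph e1)
    (hs2 : simple_graph e2) (hc2 : connected_graph e2)
    (v1 : T1) (v2 : T2) :
  let bd : {set T1 + T2} := boundary (bridge e1 e2 v1 v2) in
  let bd1 : {set T1 + T2} := [set inl x | x in boundary e1] in
  let bd2 : {set T1 + T2} := [set inr y | y in boundary e2] in
  (beta e1 v1 <> 1 -> beta e2 v2 <> 1 -> bd = bd1 :|: bd2) /\
  (beta e1 v1 = 1 -> beta e2 v2 <> 1 ->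
     bd = (bd1 :|: bd2) :\: [set inl v1]) /\
  (beta e1 v1 <> 1 -> beta e2 v2 = 1 ->
     bd = (bd1 :|: bd2) :\: [set inr v2]) /\
  (beta e1 v1 = 1 -> beta e2 v2 = 1 ->
     bd = (bd1 :|: bd2) :\: [set inl v1; inr v2]) /\
  (maxn #|boundary e1| #|boundary e2| <= #|bd|)%N.
Proof.
case: hs1 hs2 => [_ ie1] [_ ie2] bd bd1 bd2.
have bdl x := inl_boundary_bridge v1 v2 hc1 hc2 ie1 x.
have bdr y := inr_boundary_bridge v1 v2 hc1 hc2 ie2 y.
have inl_inj : injective (@inl T1 T2) by move=> ? ? [].
have inr_inj : injective (@inr T1 T2) by move=> ? ? [].
have Ul x : (inl x \in bd1 :|: bd2) = (x \in boundary e1).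
  rewrite in_setU mem_imset // orbC.
  by case: imsetP => // -[].
have Ur y : (inr y \in bd1 :|: bd2) = (y \in boundary e2).
  rewrite in_setU mem_imset //.
  by case: imsetP => // -[].
have eql a b : (inl a == inl b :> T1 + T2) = (a == b) by [].
have eqr a b : (inr a == inr b :> T1 + T2) = (a == b) by [].
have eqlr a b : (inl a == inr b :> T1 + T2) = false by [].
have eqrl a b : (inr a == inl b :> T1 + T2) = false by [].
have E := (in_setD, Ul, Ur, bdl, bdr, in_set1, in_set2, eql, eqr, eqlr, eqrl).
do 4?split.
- move=> /eqP/negPf b1 /eqP/negPf b2; apply/setP=> -[x|y];
  by rewrite !E ?b1 ?b2 ?andbF ?andbT.
- move=> /eqP b1 /eqP/negPf b2; apply/setP=> -[x|y];
  by rewrite !E ?b1 ?b2 ?andbF ?andbT // andbC.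
- move=> /eqP/negPf b1 /eqP b2; apply/setP=> -[x|y];
  by rewrite !E ?b1 ?b2 ?andbF ?andbT // andbC.
- move=> /eqP b1 /eqP b2; apply/setP=> -[x|y];
  by rewrite !E ?b1 ?b2 ?andbT ?orbF andbC.
have [x|S1 B1] := card_boundary_kept (v := v1)
  (S := [set a | inl a \in bd]) hc1 ie1.
  by rewrite inE bdl.
have [y|S2 B2] := card_boundary_kept (v := v2)
  (S := [set b | inr b \in bd]) hc2 ie2.
  by rewrite inE bdr.
(* The vertex that one trace may lose is compensated by the nonempty other trace. *)
by rewrite (card_inl_inr bd); lia.
Qed.
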